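(* Let $S$ be a monoid and let $A$ be a right $S$-act. The following are equivalent: (i) $A$ is hollow and has at least one maximal subact; (ii) $A$ is cyclic and local; (iii) $A$ is finitely generated and local; (iv) every proper subact of $A$ is contained in a maximal subact of $A$, and $A$ is local; (v) $A$ contains a maximal subact $N$ such that $N\leq_s A$; (vi) $A$ contains a maximum subact $N$ (that is, a proper subact $N$ containing every proper subact of $A$) such that $N\leq_s A$.
   Context: A right $S$-act over a monoid $S$ is a non-empty set $A$ with a unital associative right action of $S$. A subact of $A$ is a non-empty subset closed under the action; it is proper if it is not equal to $A$. A maximal subact of $A$ is a proper subact not properly contained in any other proper subact. $A$ is local if it has exactly one maximal subact. $A$ is cyclic if $A=aS$ for some $a\in A$, and finitely generated if $A=\bigcup_{i=1}^n a_iS$ for some $a_1,\dots,a_n\in A$. A subact $B$ of $A$ is superfluous in $A$, written $B\leq_s A$, if $B\cup C\neq A$ for every proper subact $C$ of $A$. $A$ is hollow if every proper subact of $A$ is superfluous in $A$. *)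

(* Defs.v *)
(* [monoidType] is not assumed finite or commutative. It carries a choice
   structure, which is no restriction under the classical axioms of [boolp]
   ([gen_eqMixin], [gen_choiceMixin]). *)
From HB Require Import structures.
From mathcomp Require Import all_boot.
From mathcomp Require Import boolp classical_sets.

Set Implicit Arguments.
Unset Strict Implicit.
Unset Printing Implicit Defensive.

Import Algebra.

Local Open Scope classical_set_scope.

Record ract (S : monoidType) := RAct {
  ract_sort :> Type;
  ract_op : ract_sort -> S -> ract_sort;
  ract_inhabited : inhabited ract_sort;
  ract_op1 : forall a, ract_op a 1%g = a;
  ract_opM : forall a s t, ract_op a (s * t)%g = ract_op (ract_op a s) t
}.

Declare Scope act_scope.
Delimit Scope act_scope with act.
Notation "a ⋅ s" := (ract_op a s) (at level 40, left associativity) : act_scope.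
Local Open Scope act_scope.

Section Acts.
Variables (S : monoidType) (A : ract S).
Implicit Types (B C M N : set A) (a : A).

Definition subact B : Prop :=
  B !=set0 /\ forall b s, B b -> B (b ⋅ s).

Definition proper_subact B : Prop := subact B /\ B <> setT.

Definition maximal_subact M : Prop :=
  proper_subact M /\ forall C, proper_subact C -> ~ (M `<` C).

Definition maximum_subact N : Prop :=
  proper_subact N /\ forall C, proper_subact C -> C `<=` N.

(* the subact aS generated by a *)
Definition principal a : set A := [set a ⋅ s | s in [set: S]].

Definition superfluous B : Prop :=
  subact B /\ forall C, proper_subact C -> B `|` C <> setT.

End Acts.

Section ActProperties.
Variables (S : monoidType) (A : ract S).

Definition local_act : Prop := exists! M : set A, maximal_subact M.

Definition cyclic_act : Prop := exists a : A, [set: A] = principal a.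

(* n = 0 is harmless: acts are inhabited, so the empty union is never A *)
Definition fg_act : Prop :=
  exists (n : nat) (a : 'I_n -> A),
    [set: A] = \bigcup_(i in [set: 'I_n]) principal (a i).

Definition hollow_act : Prop :=
  forall B : set A, proper_subact B -> superfluous B.

End ActProperties.

(* Main.v *)
(* If M is a maximal subact and B is a subact not inside M, then M `|` B is
   everything; hence a superfluous maximal subact contains every proper subact,
   and in a hollow act any a outside M generates. The existence of maximal
   subacts needs no Zorn lemma: in an act with finitely many generators a_i, add
   to a proper subact B as many of the a_i S as possible while staying proper;
   if a_j is still missed, then {x | a_j is not in xS} is a maximal subact
   containing B. *)
Require Import Defs.
From mathcomp Require Import all_boot.
From mathcomp Require Import boolp classical_sets.

Local Open Scope classical_set_scope.
Local Open Scope act_scope.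

Section SubactTheory.
Set Implicit Arguments.
Unset Strict Implicit.
Context {S : monoidType} {A : ract S}.
Implicit Types (B C M N : set A) (a : A).

Lemma principal_id a : principal a a.
Proof. by exists 1%g => //; rewrite ract_op1. Qed.

Lemma principal_closed a b s : principal a b -> principal a (b ⋅ s).
Proof. by case=> t _ <-; exists (t * s)%g => //; rewrite ract_opM. Qed.

Lemma subact_principal a : subact (principal a).
Proof.
by split=> [|b s]; [exists a; apply: principal_id | apply: principal_closed].
Qed.

Lemma principal_sub a B : subact B -> B a -> principal a `<=` B.
Proof. by case=> _ clB Ba _ [s _ <-]; apply: clB. Qed.

Lemma subactU B C : subact B -> subact C -> subact (B `|` C).
Proof.
move=> [[b Bb] clB] [_ clC]; split; first by exists b; left.
by move=> x s [/clB|/clC] h; [left | right].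
Qed.

Lemma maximal_sub_eq {M C} :
  maximal_subact M -> proper_subact C -> M `<=` C -> M = C.
Proof.
move=> [_ maxM] pC MC; apply/seteqP; split=> //.
by apply: contrapT => nCM; apply: (maxM C pC); split.
Qed.

Lemma maximal_setU {M B} :
  maximal_subact M -> subact B -> ~ B `<=` M -> M `|` B = setT.
Proof.
move=> mM sB nBM; apply: contrapT => nT; apply: nBM.
have pMB : proper_subact (M `|` B) by split=> //; apply: subactU => //; case: mM.1.
by rewrite (maximal_sub_eq mM pMB (@subsetUl _ M B)); apply: subsetUr.
Qed.

Lemma hollow_cyclic M : hollow_act A -> maximal_subact M -> cyclic_act A.
Proof.
move=> hA mM; have [[sM MT] _] := mM.
have [a nMa] : exists a, ~ M a.
  by apply/existsNP => allM; apply: MT; apply/seteqP; split.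
exists a; apply: contrapT => naT.
have [_ sup] : superfluous (principal a).
  by apply: hA; split; [apply: subact_principal | move=> e; apply: naT].
apply: (sup M mM.1); rewrite setUC; apply: (maximal_setU mM).
  exact: subact_principal.
by move=> /(_ a (principal_id a)).
Qed.

Lemma hollow_local M : hollow_act A -> maximal_subact M -> local_act A.
Proof.
move=> hA mM; exists M; split=> // N mN.
have [_ sup] := hA _ mM.1.
apply/esym/(maximal_sub_eq mN mM.1); apply: contrapT => nNM.
by apply: (sup N mN.1); apply: maximal_setU => //; case: mN.1.
Qed.

Lemma cyclic_fg : cyclic_act A -> fg_act A.
Proof.
case=> a Ea; exists 1%N, (fun=> a); rewrite Ea.
by apply/seteqP; split=> x; [exists ord0 | case].
Qed.

(** The set of all [x] with [a] outside [xS] is the largest subact missing [a]. A proper subact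
    strictly above it would contain both [C] and [a], so the hypothesis on [C] would make it
    everything. *)
Lemma maximal_avoiding C a : subact C -> ~ C a ->
  (forall D, subact D -> C `<=` D -> D a -> D = setT) ->
  maximal_subact [set x | ~ principal x a] /\ C `<=` [set x | ~ principal x a].
Proof.
move=> sC nCa maxC; set N := [set x | _].
have CN : C `<=` N by move=> x Cx /(principal_sub sC Cx).
split=> //; split=> [|D [sD nDT] [ND nDN]].
  split; first split.
  - by have [[c Cc] _] := sC; exists c; apply: CN.
  (* Generalizing over [a] turns the goal into the inclusion of [(x ⋅ s)S] in [xS]. *)
  - move=> x s nxa xsa; apply: nxa; move: a xsa {nCa maxC N CN}.
    apply: principal_sub; first exact: subact_principal.
    exact/principal_closed/principal_id.
  - by move=> NT; have : N a by [rewrite NT]; apply; apply: principal_id.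
apply: nDT; apply: maxC => //; first exact: subset_trans ND.
apply: contrapT => nDa; apply: nDN => x Dx.
by move=> /(principal_sub sD Dx).
Qed.

Lemma fg_sub_maximal B : fg_act A -> proper_subact B ->
  exists M, maximal_subact M /\ B `<=` M.
Proof.
move=> [n [a genA]] [sB nBT].
pose U (I : {set 'I_n}) := B `|` \bigcup_(i in [set i | i \in I]) principal (a i).
have sU I : subact (U I).
  have [[b Bb] clB] := sB; split; first by exists b; left.
  move=> x s [/clB|[i Ii xi]]; first by left.
  by right; exists i => //; apply: principal_closed.
have [I /maxsetP[/asboolP UI maxI]] :
    {I | maxset (fun I => `[< U I <> setT >]) I}.
  (* The empty index set qualifies, since it gives back the proper subact [B]. *)
  apply: ex_maxset; exists finset.set0; apply/asboolP.
  rewrite /U bigcup0 ?setU0 // => i /=.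
  by rewrite finset.inE.
have [j nUj] : exists j, ~ U I (a j).
  apply/existsNP => allU; apply: UI; apply/seteqP; split=> // x _.
  have : [set: A] x by [].
  by rewrite genA => -[i _]; apply: principal_sub.
have [mM UM] : maximal_subact [set x | ~ principal x (a j)] /\
    U I `<=` [set x | ~ principal x (a j)].
  apply: maximal_avoiding => // D sD UD Dj.
  (* If adding [j] left the union proper, maximality of [I] would put [j] in [I], and so [a j] in
     [U I]. *)
  have UjT : U (j |: I)%SET = setT.
    apply: contrapT => /asboolP nT; apply: nUj; right; exists j => /=.
      by rewrite -(maxI _ nT (finset.subsetUr _ _)) finset.setU11.
    exact: principal_id.
  apply/seteqP; split=> // x _; have : U (j |: I)%SET x by rewrite UjT.
  case=> [Bx|[i /= + xi]]; first by apply: UD; left.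
  rewrite finset.in_setU1 => /orP[/eqP ij|iI].
    by apply: (principal_sub sD Dj); rewrite -ij.
  by apply: UD; right; exists i.
exists [set x | ~ principal x (a j)]; split=> //.
by apply: subset_trans UM; apply: subsetUl.
Qed.

(** Any proper [C] lies in some maximal subact, which can only be [N]; joining [C] to [N] thus adds
    nothing. *)
Lemma local_superfluous :
  (forall B, proper_subact B -> exists M, maximal_subact M /\ B `<=` M) ->
  local_act A -> exists N, maximal_subact N /\ superfluous N.
Proof.
move=> exM [N [mN uniqN]]; exists N; split=> //.
split=> [|C /exM[M [mM CM]]]; first by case: mN.1.
have [[_ NT] _] := mN.
by rewrite setUidl // (uniqN M mM).
Qed.

Lemma maximal_superfluous_maximum N :
  maximal_subact N -> superfluous N -> maximum_subact N.
Proof.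
move=> mN [_ sup]; split=> [|C pC]; first by case: mN.
by apply: contrapT => nCN; apply: (sup C pC); apply: maximal_setU => //; case: pC.
Qed.

Lemma maximum_maximal N : maximum_subact N -> maximal_subact N.
Proof. by case=> pN maxN; split=> // C /maxN CN [_]; apply. Qed.

(** Two proper subacts both lie in [N], hence so does their union, which therefore cannot be
    everything. *)
Lemma maximum_hollow N : maximum_subact N -> hollow_act A.
Proof.
move=> [[_ NT] maxN] B pB; split=> [|C pC BCT]; first by case: pB.
apply: NT; apply/seteqP; split=> //; rewrite -BCT subUset.
by split; apply: maxN.
Qed.

End SubactTheory.

Theorem theorem4p4 (S : monoidType) (A : ract S) :
  [<-> (* (i) *)
       hollow_act A /\ (exists M : set A, maximal_subact M);
       (* (ii) *)
       cyclic_act A /\ local_act A;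
       (* (iii) *)
       fg_act A /\ local_act A;
       (* (iv) *)
       (forall B : set A, proper_subact B ->
          exists M : set A, maximal_subact M /\ B `<=` M) /\ local_act A;
       (* (v) *)
       exists N : set A, maximal_subact N /\ superfluous N;
       (* (vi) *)
       exists N : set A, maximum_subact N /\ superfluous N].
Proof.
tfae.
- by case=> hA [M mM]; split; [apply: hollow_cyclic mM | apply: hollow_local mM].
- by case=> /cyclic_fg.
- by case=> fgA locA; split=> // B; apply: fg_sub_maximal.
- by case; apply: local_superfluous.
- by case=> N [mN sN]; exists N; split=> //; apply: maximal_superfluous_maximum.
- case=> N [mN _]; split; first exact: maximum_hollow mN.
  by exists N; apply: maximum_maximal.
Qed.
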